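(* Let $f:\mathbb{R}^n\to\mathbb{R}$ be continuously differentiable and convex, $A\in\mathbb{R}^{m\times n}$, $b\in\mathbb{R}^m$. Suppose that $f$ is $\mu$-strongly convex with $l$-Lipschitz gradient, i.e. $lI\succeq\nabla^2f(x)\succeq\mu I$ wherever $\nabla^2f(x)$ is defined, and that $A$ has full row rank with $\sigma I\succeq AA^T\succeq\kappa I$, where $\mu,l,\sigma,\kappa>0$. Let $\eta>0$ and $\alpha>0$ satisfy $2\eta>l\alpha+\frac{\mu}{\kappa\alpha}$. Then the dynamics $$\dot x=-\nabla f(x)-\eta A^Ty-\alpha A^T\big[-\alpha A(\nabla f(x)+\eta A^Ty)+\eta(Ax-b)\big]_y^+,$$ $$\dot y=\big[-\alpha A(\nabla f(x)+\eta A^Ty)+\eta(Ax-b)\big]_y^+$$ are globally exponentially stable. More precisely, writing $z=(x,y)$, given the (unique) saddle point $z_\star$ of $L(x,y):=f(x)+\eta y^T(Ax-b)$ on $\mathbb{R}^n\times\mathbb{R}^m_{\ge0}$ and any initial point $z(0)\in\mathbb{R}^n\times\mathbb{R}^m_{\ge0}$, $$\|z(t)-z_\star\|\le K\|z(0)-z_\star\|e^{-\mu t}$$ holds (for all $t\ge0$) with $K:=\max\{2,2\sigma\alpha^2+1\}$.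
   Context: The dynamics are designed to solve $\min_{x\in\mathbb{R}^n}f(x)$ subject to $Ax-b\le0$, with dual variable $y\in\mathbb{R}^m_{\ge0}$. For $y\in\mathbb{R}^m_{\ge0}$ and $s\in\mathbb{R}^m$, $[s]_y^+$ is defined componentwise by $([s]_y^+)_j=s_j$ if $y_j>0$ and $([s]_y^+)_j=\max\{s_j,0\}$ if $y_j=0$. A saddle point of $L$ on $\mathbb{R}^n\times\mathbb{R}^m_{\ge0}$ is a point $(x_\star,y_\star)$ with $L(x_\star,y)\le L(x_\star,y_\star)\le L(x,y_\star)$ for all $x\in\mathbb{R}^n$, $y\in\mathbb{R}^m_{\ge0}$. Solutions are in the Carathéodory sense (absolutely continuous, satisfying the equations for almost every $t$, with $y(t)\ge0$). *)

(* Defs.v *)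
From mathcomp Require Export all_boot all_order all_algebra.
From mathcomp Require Export all_classical all_reals all_analysis.

Set Implicit Arguments.
Unset Strict Implicit.
Unset Printing Implicit Defensive.

Export Order.TTheory GRing.Theory Num.Theory.
Export numFieldNormedType.Exports.

Local Open Scope classical_set_scope.
Local Open Scope ring_scope.

Definition inner (R : realType) (n : nat) (u v : 'cV[R]_n) : R :=
  (u^T *m v) 0 0.

(* The norm that the library attaches to matrices is the sup norm; all metric
   quantities below use the Euclidean norm instead. The induced topologies
   coincide, so continuity and differentiability are the library's. *)
Definition enorm (R : realType) (n : nat) (u : 'cV[R]_n) : R :=
  Num.sqrt (inner u u).

Definition grad (R : realType) (n : nat) (f : 'cV[R]_n -> R) (x : 'cV[R]_n) :
    'cV[R]_n :=
  \col_(i < n) 'D_(delta_mx i 0) f x.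

Definition continuously_differentiable (R : realType) (n : nat)
    (f : 'cV[R]_n -> R) : Prop :=
  (forall x, differentiable f x) /\ continuous (grad f).

Definition strongly_convex (R : realType) (n : nat) (mu : R)
    (f : 'cV[R]_n -> R) : Prop :=
  forall (x y : 'cV[R]_n) (t : R), 0 <= t <= 1 ->
    f (t *: x + (1 - t) *: y) <=
      t * f x + (1 - t) * f y - mu / 2 * t * (1 - t) * enorm (x - y) ^+ 2.

Definition lipschitz_gradient (R : realType) (n : nat) (l : R)
    (f : 'cV[R]_n -> R) : Prop :=
  forall x y : 'cV[R]_n, enorm (grad f x - grad f y) <= l * enorm (x - y).

Definition psdmx (R : realType) (n : nat) (M : 'M[R]_n) : Prop :=
  M^T = M /\ forall v : 'cV[R]_n, 0 <= inner v (M *m v).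

Definition loewner_le (R : realType) (n : nat) (M N : 'M[R]_n) : Prop :=
  psdmx (N - M).

Definition nneg_vec (R : realType) (m : nat) (y : 'cV[R]_m) : Prop :=
  forall j, 0 <= y j 0.

(* [s]_y^+; only meaningful for y in the nonnegative orthant, where the
   second branch is the case y_j = 0. *)
Definition proj_plus (R : realType) (m : nat) (s y : 'cV[R]_m) : 'cV[R]_m :=
  \col_(j < m) (if 0 < y j 0 then s j 0 else Num.max (s j 0) 0).

Definition lagrangian (R : realType) (n m : nat) (f : 'cV[R]_n -> R)
    (A : 'M[R]_(m, n)) (b : 'cV[R]_m) (eta : R)
    (x : 'cV[R]_n) (y : 'cV[R]_m) : R :=
  f x + eta * inner y (A *m x - b).

Definition saddle_point (R : realType) (n m : nat)
    (L : 'cV[R]_n -> 'cV[R]_m -> R) (xs : 'cV[R]_n) (ys : 'cV[R]_m) : Prop :=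
  nneg_vec ys /\
  forall (x : 'cV[R]_n) (y : 'cV[R]_m), nneg_vec y ->
    L xs y <= L xs ys /\ L xs ys <= L x ys.

Definition dual_field (R : realType) (n m : nat) (f : 'cV[R]_n -> R)
    (A : 'M[R]_(m, n)) (b : 'cV[R]_m) (eta alpha : R)
    (x : 'cV[R]_n) (y : 'cV[R]_m) : 'cV[R]_m :=
  proj_plus
    (- alpha *: (A *m (grad f x + eta *: (A^T *m y))) + eta *: (A *m x - b)) y.

Definition primal_field (R : realType) (n m : nat) (f : 'cV[R]_n -> R)
    (A : 'M[R]_(m, n)) (b : 'cV[R]_m) (eta alpha : R)
    (x : 'cV[R]_n) (y : 'cV[R]_m) : 'cV[R]_n :=
  - grad f x - eta *: (A^T *m y)
  - alpha *: (A^T *m dual_field f A b eta alpha x y).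

Definition absolutely_continuous_on (R : realType) (n : nat) (c d : R)
    (u : R -> 'cV[R]_n) : Prop :=
  forall eps : R, 0 < eps -> exists2 delta : R, 0 < delta &
    forall (N : nat) (p q : 'I_N -> R),
      (forall i, c <= p i /\ p i <= q i /\ q i <= d) ->
      trivIset [set: 'I_N] (fun i => `]p i, q i[%classic) ->
      \sum_(i < N) (q i - p i) < delta ->
      \sum_(i < N) enorm (u (q i) - u (p i)) < eps.

(* Solutions live on [0, +oo[; the values of x and y at negative times are
   irrelevant, and absolute continuity is required on every [0, T]. *)
Definition caratheodory_solution (R : realType) (n m : nat)
    (F : 'cV[R]_n -> 'cV[R]_m -> 'cV[R]_n)
    (G : 'cV[R]_n -> 'cV[R]_m -> 'cV[R]_m)
    (x : R -> 'cV[R]_n) (y : R -> 'cV[R]_m) : Prop :=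
  [/\ forall T : R, 0 <= T -> absolutely_continuous_on 0 T x,
      forall T : R, 0 <= T -> absolutely_continuous_on 0 T y,
      forall t : R, 0 <= t -> nneg_vec (y t) &
      {ae (@lebesgue_measure R), forall t : R, 0 < t ->
         is_derive t (1 : R) x (F (x t) (y t)) /\ is_derive t (1 : R) y (G (x t) (y t))}].

(* Main.v *)
(* With [w = x + alpha A^T y] the dynamics read [w' = - (grad f x + eta A^T y)]
   and [y' = proj_plus s y].  Writing [X], [Y], [g] for the deviations of [x],
   [y], [grad f x] from their values at the saddle point, the function
   [V = |X + alpha A^T Y|^2 + |Y|^2] satisfies
   [V' / 2 <= - <g, X> - 2 alpha <g, A^T Y> - 2 alpha eta |A^T Y|^2],
   and co-coercivity of the gradient together with the condition on the
   parameters bounds the right-hand side by [- mu V].  Hence [e^(2 mu t) V]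
   is absolutely continuous with nonpositive derivative almost everywhere,
   and [V] and [|X|^2 + |Y|^2] are within a factor [K] of each other.

   For existence of the saddle point, a right inverse of [A] turns the
   first-order conditions at the minimizer of [f] on [A x <= b] into explicit
   multipliers. *)
Require Import Defs.
From mathcomp Require Import ring lra.
Set Implicit Arguments.
Unset Strict Implicit.
Unset Printing Implicit Defensive.
Local Open Scope classical_set_scope.
Local Open Scope ring_scope.

(** * Euclidean inner product and gradient inequalities *)

Section inner_product.
Context {R : realType}.

Lemma innerE n (u v : 'cV[R]_n) : inner u v = \sum_i u i 0 * v i 0.
Proof. by rewrite /inner mxE; apply: eq_bigr => i _; rewrite mxE. Qed.

Lemma innerC n (u v : 'cV[R]_n) : inner u v = inner v u.
Proof. by rewrite !innerE; apply: eq_bigr => i _; rewrite mulrC. Qed.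

Lemma innerDr n (u v w : 'cV[R]_n) : inner u (v + w) = inner u v + inner u w.
Proof. by rewrite /inner mulmxDr mxE. Qed.

Lemma innerDl n (u v w : 'cV[R]_n) : inner (u + v) w = inner u w + inner v w.
Proof. by rewrite innerC innerDr !(innerC w). Qed.

Lemma innerZr n (k : R) (u v : 'cV[R]_n) : inner u (k *: v) = k * inner u v.
Proof. by rewrite /inner -scalemxAr mxE. Qed.

Lemma innerZl n (k : R) (u v : 'cV[R]_n) : inner (k *: u) v = k * inner u v.
Proof. by rewrite innerC innerZr innerC. Qed.

Lemma innerNr n (u v : 'cV[R]_n) : inner u (- v) = - inner u v.
Proof. by rewrite -scaleN1r innerZr mulN1r. Qed.

Lemma innerNl n (u v : 'cV[R]_n) : inner (- u) v = - inner u v.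
Proof. by rewrite innerC innerNr innerC. Qed.

Lemma inner0r n (u : 'cV[R]_n) : inner u 0 = 0.
Proof. by rewrite /inner mulmx0 mxE. Qed.

Lemma inner0l n (u : 'cV[R]_n) : inner 0 u = 0.
Proof. by rewrite innerC inner0r. Qed.

Lemma inner_mulmxr n m (A : 'M[R]_(m, n)) (y : 'cV[R]_m) (x : 'cV[R]_n) :
  inner y (A *m x) = inner (A^T *m y) x.
Proof. by rewrite /inner trmx_mul trmxK mulmxA. Qed.

Definition inner_lin := (innerDl, innerDr, innerNl, innerNr, innerZl, innerZr).

Lemma inner_ge0 n (u : 'cV[R]_n) : 0 <= inner u u.
Proof. by rewrite innerE; apply: sumr_ge0 => i _; rewrite -expr2 sqr_ge0. Qed.

Lemma inner_eq0 n (u : 'cV[R]_n) : inner u u = 0 -> u = 0.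
Proof.
rewrite innerE => /eqP; rewrite psumr_eq0; last first.
  by move=> i _; rewrite -expr2 sqr_ge0.
move=> /allP u0; apply/colP => i; rewrite mxE.
have /= := u0 i (mem_index_enum _).
by rewrite -expr2 sqrf_eq0 => /eqP.
Qed.

Lemma enorm_sqr n (u : 'cV[R]_n) : enorm u ^+ 2 = inner u u.
Proof. by rewrite sqr_sqrtr ?inner_ge0. Qed.

Lemma enorm_ge0 n (u : 'cV[R]_n) : 0 <= enorm u.
Proof. exact: sqrtr_ge0. Qed.

Lemma enormZ n (k : R) (u : 'cV[R]_n) : enorm (k *: u) = `|k| * enorm u.
Proof.
by rewrite /enorm innerZl innerZr mulrA -expr2 sqrtrM ?sqr_ge0// sqrtr_sqr.
Qed.

Lemma enormN n (u : 'cV[R]_n) : enorm (- u) = enorm u.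
Proof. by rewrite /enorm innerNl innerNr opprK. Qed.

(** Cauchy-Schwarz: expanding [|b u - a v|^2 >= 0] with [a = |u|], [b = |v|] gives
    [a b (a b - <u, v>) >= 0]; if [a b = 0], one of the vectors vanishes. *)
Lemma inner_le_enorm n (u v : 'cV[R]_n) : inner u v <= enorm u * enorm v.
Proof.
set a := enorm u; set b := enorm v.
have a0 : 0 <= a := enorm_ge0 _.
have b0 : 0 <= b := enorm_ge0 _.
have := inner_ge0 (b *: u - a *: v).
rewrite !inner_lin -!enorm_sqr -/a -/b (innerC v u) => h.
have {}h : 0 <= (a * b) * (a * b - inner u v) by nra.
have [ab0|] := ltP 0 (a * b); first by rewrite -subr_ge0; rewrite pmulr_rge0 in h.
move=> ab0; have /eqP : a * b = 0 by apply/le_anti; rewrite ab0 mulr_ge0.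
rewrite mulf_eq0 => /orP[] /eqP e0.
- have -> : u = 0 by apply: inner_eq0; rewrite -enorm_sqr -/a e0 expr0n.
  by rewrite inner0l mulr_ge0.
- have -> : v = 0 by apply: inner_eq0; rewrite -enorm_sqr -/b e0 expr0n.
  by rewrite inner0r mulr_ge0.
Qed.

Lemma inner_col_mx n m (u u' : 'cV[R]_n) (v v' : 'cV[R]_m) :
  inner (col_mx u v) (col_mx u' v') = inner u u' + inner v v'.
Proof. by rewrite /inner tr_col_mx mul_row_col mxE. Qed.

Lemma entry_le_enorm n (u : 'cV[R]_n) i : `|u i 0| <= enorm u.
Proof.
rewrite -sqrtr_sqr ler_wsqrtr// innerE (bigD1 i)//= -expr2 lerDl.
by apply: sumr_ge0 => j _; rewrite -expr2 sqr_ge0.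
Qed.

End inner_product.

Lemma scaleRE (R : numDomainType) (a b : R) : a *: (b : R^o) = a * b.
Proof. by []. Qed.

Section gradient.
Context {R : realType} {n : nat}.
Implicit Types (f : 'cV[R]_n -> R) (x d : 'cV[R]_n).

Lemma cV_sum_delta d : d = \sum_i d i 0 *: delta_mx i 0.
Proof.
rewrite {1}(matrix_sum_delta d); apply: eq_bigr => i _.
by rewrite big_ord1.
Qed.

Lemma derive_inner_grad f x d :
  differentiable f x -> 'D_d f x = inner (grad f x) d.
Proof.
move=> df; rewrite deriveE// {1}(cV_sum_delta d) linear_sum innerE.
by apply: eq_bigr => i _; rewrite linearZ /= mxE deriveE// mulrC.
Qed.

(** The two difference quotients coincide as functions of [h], so derivability and value carry
    over. *)
Lemma is_derive_line f x d (t : R) : differentiable f (x + t *: d) ->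
  is_derive t 1 (fun s => f (x + s *: d)) (inner (grad f (x + t *: d)) d).
Proof.
move=> df.
have e h : h^-1 *: (f (x + (h *: 1 + t) *: d) - f (x + t *: d)) =
    h^-1 *: (f (h *: d + (x + t *: d)) - f (x + t *: d)).
  congr (_ *: (f _ - _)); rewrite [h *: 1]mulr1 scalerDl.
  by rewrite addrCA.
have cv : derivable f (x + t *: d) d by exact: diff_derivable.
have q : (fun h => h^-1 *: (((fun s => f (x + s *: d)) \o shift t) (h *: 1) -
   f (x + t *: d))) = (fun h => h^-1 *: ((f \o shift (x + t *: d)) (h *: d) -
   f (x + t *: d))) by apply/funext => h /=; exact: e.
split; first by rewrite /derivable q.
by rewrite -derive_inner_grad// /derive q.
Qed.

End gradient.

(** * Quadratic bounds below and above *)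

Section gradient_bounds.
Context {R : realType} {n : nat}.
Variable f : 'cV[R]_n -> R.
Hypothesis df : forall x, differentiable f x.

(** Strong convexity at [h p + (1 - h) x = x + h d], divided by [h], bounds the difference quotient;
    then [h] tends to [0] from the right. *)
Lemma strongly_convex_lower mu (x p : 'cV[R]_n) : strongly_convex mu f ->
  f x + inner (grad f x) (p - x) + mu / 2 * inner (p - x) (p - x) <= f p.
Proof.
move=> sc; set d := p - x; set c := mu / 2 * inner d d.
have [] : is_derive (0 : R) (1 : R) (fun s : R => f (x + s *: d)) (inner (grad f x) d).
  by rewrite -{2}[x]addr0 -(scale0r d); apply: is_derive_line.
set g := fun s : R => f (x + s *: d) => dg g'.
have cvD : h^-1 *: (g (h *: 1 + 0) - g 0) @[h --> 0^'+] --> inner (grad f x) d.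
  by rewrite -g'; exact: (cvg_dnbhs_at_right dg).
have cvB : f p - f x - c * (1 - h) @[h --> (0 : R)^'+] --> f p - f x - c * (1 - 0).
  apply: cvg_at_right_filter; apply: cvgB; first exact: cvg_cst.
  by apply: cvgMr; apply: cvgB; [exact: cvg_cst|exact: cvg_id].
suff : inner (grad f x) d <= f p - f x - c * (1 - 0) by lra.
apply: ler_cvg_to cvD cvB _; near=> h.
have h0 : 0 < h by [].
have h1 : h < 1 by near: h; exact: nbhs_right_lt.
have h01 : 0 <= h <= 1 by rewrite !ltW.
have := sc p x h h01; rewrite enorm_sqr -/d.
have -> : h *: p + (1 - h) *: x = x + h *: d.
  by rewrite scalerBr scalerBl scale1r addrCA.
move=> sch; rewrite [h *: 1]mulr1 addr0 /g scale0r addr0 -[leLHS]/(h^-1 * _) mulrC ler_pdivrMr//.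
by rewrite /c; nra.
Unshelve. all: by end_near. Qed.

(** The function [h] is the gap along the segment, and [h'] is nonpositive on []0, 1[] by
    Cauchy-Schwarz and the Lipschitz bound, so the mean value theorem gives [h 1 <= h 0]. *)
Lemma lipschitz_gradient_upper l (x p : 'cV[R]_n) : lipschitz_gradient l f ->
  f p <= f x + inner (grad f x) (p - x) + l / 2 * inner (p - x) (p - x).
Proof.
move=> lip; set d := p - x.
pose g (s : R) := f (x + s *: d).
pose h := fun s : R => g s - s * inner (grad f x) d - s ^+ 2 * (l / 2 * inner d d).
pose h' := fun s : R => inner (grad f (x + s *: d)) d - inner (grad f x) d -
   s * (l * inner d d).
have dh (s : R) : is_derive s (1 : R) h (h' s).
  have dg : is_derive s (1 : R) g _ := is_derive_line (df _).
  rewrite /h; apply: is_derive_eq.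
  rewrite /h' /= !scaleRE !mulr0 !mulr1.
  by field.
have [c /itvP c01 hc] : exists2 c, c \in `]0, 1[ & h 1 - h 0 = h' c * (1 - 0).
  apply: MVT => //.
  apply: continuous_subspaceT => s; apply: differentiable_continuous.
  exact/derivable1_diffP.
suff : h' c <= 0.
  move: hc; rewrite /h /g scale0r addr0 scale1r [x + d]addrC subrK; lra.
have := inner_le_enorm (grad f (x + c *: d) - grad f x) d.
have := lip (x + c *: d) x; rewrite addrAC subrr add0r enormZ.
rewrite ger0_norm ?c01// innerDl innerNl /h' -enorm_sqr.
have := enorm_ge0 d; set a := enorm _; set b := enorm _; nra.
Qed.

(* Co-coercivity of the gradient of [f - mu/2 |.|^2], written without dividing
   by [l - mu], which may vanish. *)
Lemma gradient_cocoercive mu l (x p v : 'cV[R]_n) :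
    strongly_convex mu f -> lipschitz_gradient l f ->
  mu * inner (x - p + v) (x - p + v) <=
  inner (grad f x - grad f p) (x - p + 2 *: v) + l * inner v v.
Proof.
move=> sc lip.
(* Both [f (p - v)] and [f (x + v)] are bounded below from the far base point and above from the
   near one; in the sum all values of [f] cancel. *)
have := strongly_convex_lower x (p - v) sc.
have := strongly_convex_lower p (x + v) sc.
have := lipschitz_gradient_upper p (p - v) lip.
have := lipschitz_gradient_upper x (x + v) lip.
rewrite ![_ + v - x]addrAC ![_ - v - p]addrAC !subrr !add0r.
have -> : x + v - p = x - p + v by rewrite addrAC.
have -> : p - v - x = - (x - p + v) by rewrite [LHS]addrAC !opprD opprK (addrC p).
rewrite !inner_lin; lra.
Qed.

End gradient_bounds.

(** * Saddle points *)

Lemma trmx_continuous (R : realType) m n :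
  continuous (fun M : 'M[R]_(m, n) => M^T).
Proof.
have normT (M : 'M[R]_(m, n)) : `|M^T| <= `|M|.
  rewrite [leLHS]/Num.Def.normr/= [leRHS]/Num.Def.normr/= !mx_normrE.
  apply: bigmax_le => [|[i j] _ /=]; first exact: bigmax_ge_id.
  by rewrite mxE; exact: (le_bigmax _ (fun k => `|M k.1 k.2|) (j, i)).
move=> M; apply: (proj2 (@cvgrPdist_lt _ _ _ (nbhs M) _ (fun N : 'M[R]_(m, n) => N^T) M^T)).
move=> e e0; near=> N.
rewrite -linearB; apply: le_lt_trans (normT _) _.
near: N; by apply: (@cvgr_dist_lt _ _ _ (nbhs M) _ id M) => //; exact: cvg_id.
Unshelve. all: by end_near. Qed.

Lemma mulmx_entry_continuous (R : realType) m n (A : 'M[R]_(m, n)) j :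
  continuous (fun x : 'cV[R]_n => (A *m x) j 0).
Proof.
have -> : (fun x : 'cV[R]_n => (A *m x) j 0) = (fun x => \sum_i A j i * x i 0).
  by apply/funext => x; rewrite mxE.
apply: continuous_big => [|i _ x]; first exact: add_continuous.
have h := @coord_continuous R n 1 i 0 x.
apply: continuousM; first exact: cst_continuous. exact: h.
Qed.

(** Heine-Borel for row vectors, carried to columns by the continuity of transposition. *)
Lemma cV_bounded_closed_compact (R : realType) n (S : set 'cV[R]_n) (M : R) :
  (forall x, S x -> forall i, `|x i 0| <= M) -> closed S -> compact S.
Proof.
move=> bS cS.
have -> : S = (fun r : 'rV[R]_n => r^T) @` [set r | S r^T].
  apply/seteqP; split => x /=; last by case=> r Sr <-.
  by move=> Sx; exists x^T; rewrite ?trmxK.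
apply: continuous_compact.
  by apply: continuous_subspaceT; exact: trmx_continuous.
apply: bounded_closed_compact; last first.
  by move/continuous_closedP : (@trmx_continuous R 1 n); exact.
exists (Num.max M 0); split; first exact: num_real.
move=> N /ltW MN r Sr; apply: le_trans MN.
rewrite [leLHS]/Num.Def.normr/= mx_normrE.
apply: bigmax_le => [|[i j] _ /=]; first by rewrite le_max lexx orbT.
rewrite le_max; apply/orP; left.
by have := bS _ Sr j; rewrite mxE (ord1 i).
Qed.

(** * Minimizers and first-order conditions *)

Section minimizer.
Context {R : realType} {n : nat}.
Variables (f : 'cV[R]_n -> R) (mu : R).
Hypothesis df : forall x, differentiable f x.
Hypothesis mu_gt0 : 0 < mu.
Hypothesis f_strong : strongly_convex mu f.

Lemma strongly_convex_minimizer (C : set 'cV[R]_n) : closed C -> C !=set0 ->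
  exists2 x, C x & forall p, C p -> f x <= f p.
Proof.
move=> clC [p0 Cp0].
have cf : continuous f by move=> x; exact: differentiable_continuous.
pose S := C `&` [set x | f x <= f p0].
have cS : compact S.
  pose g := enorm (grad f p0).
  (* On the sublevel set the quadratic lower bound at [p0] gives [mu / 2 r^2 <= g r] for
     [r = |x - p0|], hence [r <= 2 g / mu]. *)
  apply: (@cV_bounded_closed_compact _ _ _ (2 * g / mu + enorm p0)).
    move=> x [_ /= fx] i.
    have := strongly_convex_lower df p0 x f_strong.
    have := inner_le_enorm (grad f p0) (- (x - p0)).
    rewrite innerNr enormN -/g -enorm_sqr => h1 h2.
    have r0 := enorm_ge0 (x - p0).
    have gr : enorm (x - p0) <= 2 * g / mu.
      rewrite ler_pdivlMr//.
      have [//|r1] := ltP 0 (enorm (x - p0)); last first.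
        have -> : enorm (x - p0) = 0 by apply/le_anti; rewrite r0 r1.
        by rewrite mul0r mulr_ge0// enorm_ge0.
      move=> r1; rewrite -(ler_pM2l r1); nra.
    have := entry_le_enorm (x - p0) i; have := entry_le_enorm p0 i.
    rewrite !mxE => e1 e2.
    rewrite -(subrK (p0 i 0) (x i 0)); apply: le_trans (ler_normD _ _) _.
    by apply: lerD => //; exact: le_trans gr.
  apply: closedI => //.
  by apply: closed_comp (@closed_le _ (f p0)) => x _; exact: cf.
have [||x /set_mem[Cx fx] minx] := @compact_EVT_min _ _ f S _ cS.
- by exists p0; split => /=.
- exact: continuous_subspaceT.
exists x => // p Cp; have [fp|/ltW fp] := leP (f p) (f p0).
  by apply: minx; apply/mem_set.
by apply: le_trans fp; apply: fx.
Qed.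

(** The right derivative at a minimum is nonnegative. The term [c] carries the linear part of the
    Lagrangian; for a constrained minimizer of [f] it is [0]. *)
Lemma minimizer_variation x d c : differentiable f x ->
  (forall t, 0 < t <= 1 -> f x <= f (x + t *: d) + t * c) ->
  0 <= inner (grad f x) d + c.
Proof.
move=> dfx fx.
have [] : is_derive (0 : R) (1 : R) (fun s : R => f (x + s *: d)) (inner (grad f x) d).
  by rewrite -{2}[x]addr0 -(scale0r d); apply: is_derive_line; rewrite scale0r addr0.
set g := fun s : R => f (x + s *: d) => dg g'.
have cvD : h^-1 *: (g (h *: 1 + 0) - g 0) @[h --> 0^'+] --> inner (grad f x) d.
  by rewrite -g'; exact: (cvg_dnbhs_at_right dg).
apply: ler_cvg_to (cvg_cst 0) (cvgD cvD (cvg_cst c)) _; near=> h.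
have h0 : 0 < h by [].
have h1 : h <= 1 by near: h; exact: nbhs_right_ltW.
change (0 <= h^-1 * (g (h * 1 + 0) - g 0) + c).
rewrite mulr1 addr0 /g scale0r addr0.
have -> : h^-1 * (f (x + h *: d) - f x) + c = h^-1 * (f (x + h *: d) + h * c - f x).
  by field; rewrite gt_eqF.
by rewrite mulr_ge0 ?invr_ge0 ?(ltW h0)// subr_ge0 fx// h0.
Unshelve. all: by end_near. Qed.

End minimizer.

(** * Existence and uniqueness of the saddle point *)

Section saddle.
Context {R : realType} {n m : nat}.
Variables (f : 'cV[R]_n -> R) (A : 'M[R]_(m, n)) (b : 'cV[R]_m) (mu eta : R).
Hypothesis df : forall x, differentiable f x.
Hypothesis mu_gt0 : 0 < mu.
Hypothesis f_strong : strongly_convex mu f.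
Hypothesis A_full : row_free A.
Hypothesis eta_gt0 : 0 < eta.

Let L := lagrangian f A b eta.

(** Varying [xs] in the direction [- v], where [v] is the gradient of the Lagrangian in [x], yields
    [0 <= - |v|^2]. *)
Lemma saddle_stationary xs ys : saddle_point L xs ys ->
  grad f xs + eta *: (A^T *m ys) = 0.
Proof.
move=> [ys0 sad]; set v := _ + _; apply: inner_eq0.
apply/le_anti; rewrite inner_ge0 andbT -oppr_ge0 -innerNr innerDl.
apply: minimizer_variation => // t _.
have [_ ] := sad (xs + t *: - v) ys ys0.
rewrite /L /lagrangian mulmxDr -scalemxAr !innerDr innerZr (inner_mulmxr _ _ (- v)) innerZl.
lra.
Qed.

(** The Lagrangian is affine in [y], so maximality of [ys] becomes a variational inequality, the
    form of complementary slackness used below. *)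
Lemma saddle_complementarity xs ys y : saddle_point L xs ys -> nneg_vec y ->
  inner (y - ys) (A *m xs - b) <= 0.
Proof.
move=> [_ /(_ xs y) + y0] => /(_ y0)[+ _].
by rewrite /L /lagrangian lerD2l ler_pM2l// innerDl innerNl subr_le0.
Qed.

Lemma tr_row_free_inj (y : 'cV[R]_m) : A^T *m y = 0 -> y = 0.
Proof.
move=> Ay; rewrite -[y]mul1mx -(trmx1 R m) -(mulmxVp A_full) trmx_mul -mulmxA Ay.
by rewrite mulmx0.
Qed.

Lemma saddle_unique xs ys xs' ys' :
  saddle_point L xs ys -> saddle_point L xs' ys' -> xs = xs' /\ ys = ys'.
Proof.
move=> sad sad'.
have st := saddle_stationary sad; have st' := saddle_stationary sad'.
have co := saddle_complementarity sad (proj1 sad').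
have co' := saddle_complementarity sad' (proj1 sad).
have gE : grad f xs = - (eta *: (A^T *m ys)) by apply/eqP; rewrite -addr_eq0 st.
have gE' : grad f xs' = - (eta *: (A^T *m ys')) by apply/eqP; rewrite -addr_eq0 st'.
have lo := strongly_convex_lower df xs xs' f_strong.
have lo' := strongly_convex_lower df xs' xs f_strong.
(* The sum of [lo] and [lo'] gives [mu |X|^2 <= <grad f xs - grad f xs', X>] for [X = xs - xs']. By
   stationarity the right side is [- eta <ys - ys', A X>], which [co] and [co'] make nonpositive. *)
have X0 : xs - xs' = 0.
  apply: inner_eq0; apply/le_anti; rewrite inner_ge0 andbT.
  rewrite -(pmulr_rle0 _ mu_gt0).
  have := mulr_ge0_le0 (ltW eta_gt0) co; have := mulr_ge0_le0 (ltW eta_gt0) co'.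
  move: lo lo'; rewrite gE gE' !inner_lin !inner_mulmxr (innerC xs' xs).
  lra.
have xE : xs = xs' by apply/eqP; rewrite -subr_eq0 X0.
split=> //; apply/eqP; rewrite -subr_eq0; apply/eqP; apply: tr_row_free_inj.
apply: (@scalerI _ _ eta); first by rewrite gt_eqF.
rewrite scaler0 mulmxBr scalerBr.
by move: gE; rewrite xE gE' => /oppr_inj ->; rewrite subrr.
Qed.

Lemma saddle_exists : exists xs ys, saddle_point L xs ys.
Proof.
set B := pinvmx A; have AB : A *m B = 1%:M := mulmxVp A_full.
pose C : set 'cV[R]_n := [set x | forall j, (A *m x) j 0 <= b j 0].
have clC : closed C.
  have -> : C = \bigcap_j (fun x => (A *m x) j 0) @^-1` [set r | r <= b j 0].
    by apply/seteqP; split => x /= Cx j; move: (Cx j) => //; exact.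
  apply: closed_bigI => j _; apply: closed_comp (@closed_le _ _) => x _.
  exact: mulmx_entry_continuous.
have C0 : C !=set0 by exists (B *m b) => j; rewrite mulmxA AB mul1mx.
have [xs Cxs minxs] := strongly_convex_minimizer df mu_gt0 f_strong clC C0.
(* The candidate solution of [A^T lam = - grad f xs]; it is one because the gradient annihilates the
   kernel of [A]. *)
pose lam : 'cV[R]_m := - (B^T *m grad f xs).
have var d : C (xs + d) -> 0 <= inner (grad f xs) d.
  move=> Cd; rewrite -[inner _ _]addr0; apply: minimizer_variation => // t t01.
  rewrite mulr0 addr0; apply: minxs => j.
  have := Cd j; have := Cxs j; rewrite !mulmxDr -scalemxAr !mxE.
  set u := \sum_i _; set w := \sum_i _; nra.
have ker d : A *m d = 0 -> inner (grad f xs) d = 0.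
  move=> Ad; apply/le_anti/andP; split.
    by rewrite -oppr_ge0 -innerNr; apply: var => j; rewrite mulmxBr Ad subr0.
  by apply: var => j; rewrite mulmxDr Ad addr0.
have gradE d : inner (grad f xs) d = - inner lam (A *m d).
  have := ker (d - B *m (A *m d)); rewrite mulmxBr mulmxA AB mul1mx subrr.
  move=> /(_ erefl)/eqP.
  rewrite innerDr innerNr (inner_mulmxr B) subr_eq0 => /eqP ->.
  by rewrite /lam innerNl opprK.
have lam0 : nneg_vec lam.
  (* Moving along [- B e_j] loosens the constraint [j] alone, so it is feasible. *)
  move=> j; have := var (- (B *m delta_mx j 0)).
  rewrite innerNr gradE opprK mulmxA AB mul1mx.
  rewrite innerE (bigD1 j)//= big1 => [|i ij]; last first.
    by rewrite !mxE (negbTE ij) mulr0.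
  rewrite !mxE !eqxx mulr1 addr0; apply => i.
  rewrite mulmxBr mulmxA AB mul1mx !mxE.
  by apply: le_trans (Cxs i); rewrite mxE lerBlDr lerDl; case: (_ && _).
have lamr : 0 <= inner lam (A *m xs - b).
  (* This direction makes every constraint active; with [r0] it forces [<lam, A xs - b> = 0]. *)
  have := var (- (B *m (A *m xs - b))).
  rewrite innerNr gradE opprK mulmxA AB mul1mx; apply => i.
  by rewrite mulmxBr mulmxA AB mul1mx opprB addrC subrK.
have r0 (y : 'cV[R]_m) : nneg_vec y -> inner y (A *m xs - b) <= 0.
  move=> y0; rewrite innerE; apply: sumr_le0 => j _.
  have := Cxs j; have := y0 j; rewrite !mxE => h1 h2; rewrite mulr_ge0_le0// subr_le0//.
(* The Lagrangian weighs the constraints by [eta], hence the rescaled multiplier. *)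
exists xs, (eta^-1 *: lam); split => [j|x y y0].
  by rewrite mxE mulr_ge0// invr_ge0 ltW.
have lamr0 : inner lam (A *m xs - b) = 0 by apply/le_anti/andP; split; first exact: r0.
rewrite /L /lagrangian !innerZl !mulrA divff ?gt_eqF// !mul1r lamr0 addr0; split.
  by rewrite gerDl; apply: mulr_ge0_le0; [exact: ltW|exact: r0].
have := strongly_convex_lower df xs x f_strong.
have : 0 <= mu / 2 * inner (x - xs) (x - xs) by rewrite mulr_ge0 ?inner_ge0// divr_ge0// ltW.
rewrite gradE mulmxBr; move: lamr0; rewrite !innerDr !innerNr; lra.
Qed.

End saddle.

(** * Monotonicity of absolutely continuous functions *)

Section scalar_absolute_continuity.
Context {R : realType}.
Implicit Types (g h : R -> R) (c d : R).

Definition abs_cont c d g : Prop :=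
  forall eps : R, 0 < eps -> exists2 delta : R, 0 < delta &
    forall (N : nat) (p q : 'I_N -> R),
      (forall i, c <= p i /\ p i <= q i /\ q i <= d) ->
      trivIset [set: 'I_N] (fun i => `]p i, q i[%classic) ->
      \sum_(i < N) (q i - p i) < delta ->
      \sum_(i < N) `|g (q i) - g (p i)| < eps.

(** Common source of the closure properties for constants, sums, multiples and products: each only
    has to bound its increments. *)
Lemma abs_cont_dominated c d g h1 h2 (M : R) :
  abs_cont c d h1 -> abs_cont c d h2 ->
  (forall s t, c <= s -> s <= t -> t <= d ->
     `|g t - g s| <= M * (`|h1 t - h1 s| + `|h2 t - h2 s|)) ->
  abs_cont c d g.
Proof.
move=> ac1 ac2 dom e e0.
(* [M] may be zero or negative; [K] can be divided by. *)
pose K := Num.max M 1; have K0 : 0 < K by rewrite lt_max ltr01 orbT.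
have e20 : 0 < e / (2 * K) by rewrite divr_gt0// mulr_gt0.
have [d1 d10 H1] := ac1 _ e20; have [d2 d20 H2] := ac2 _ e20.
exists (Num.min d1 d2) => [|N p q pq triv]; first by rewrite lt_min d10.
rewrite lt_min => /andP[/(H1 _ _ _ pq triv) h1e /(H2 _ _ _ pq triv) h2e].
apply: (@le_lt_trans _ _ (K * (\sum_(i < N) `|h1 (q i) - h1 (p i)| +
                               \sum_(i < N) `|h2 (q i) - h2 (p i)|))).
  rewrite -big_split mulr_sumr; apply: ler_sum => i _ /=.
  have [cp [pqi qd]] := pq i.
  apply: le_trans (dom _ _ cp pqi qd) _.
  by rewrite ler_wpM2r ?addr_ge0// le_max lexx.
rewrite mulrC -ltr_pdivlMr//; have -> : e / K = e / (2 * K) + e / (2 * K).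
  by field; rewrite gt_eqF.
exact: ltrD.
Qed.

Lemma abs_cont_id c d : abs_cont c d id.
Proof.
move=> e e0; exists e => // N p q pq _; congr (_ < _).
by apply: eq_bigr => i _; rewrite ger0_norm// subr_ge0; case: (pq i) => _ [].
Qed.

Lemma abs_cont_cst c d k : abs_cont c d (fun=> k).
Proof.
apply: (abs_cont_dominated (M := 0) (abs_cont_id c d) (abs_cont_id c d)) => s t _ _ _.
by rewrite subrr normr0 mul0r.
Qed.

Lemma abs_cont_lipschitz c d g (M : R) :
  (forall s t, c <= s -> s <= t -> t <= d -> `|g t - g s| <= M * (t - s)) ->
  abs_cont c d g.
Proof.
move=> lip; apply: (abs_cont_dominated (M := M) (abs_cont_id c d) (abs_cont_cst c d 0)).
move=> s t cs st td; rewrite subrr normr0 addr0 (@ger0_norm _ (t - s)) ?subr_ge0//.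
exact: (lip s t cs st td).
Qed.

Lemma abs_contD c d g h : abs_cont c d g -> abs_cont c d h ->
  abs_cont c d (fun t => g t + h t).
Proof.
move=> ag ah; apply: (abs_cont_dominated (M := 1) ag ah) => s t _ _ _.
by rewrite mul1r opprD addrACA ler_normD.
Qed.

Lemma abs_contZ c d k g : abs_cont c d g -> abs_cont c d (fun t => k * g t).
Proof.
move=> ag; apply: (abs_cont_dominated (M := `|k|) ag (abs_cont_cst c d 0)) => s t _ _ _.
by rewrite subrr normr0 addr0 -normrM mulrBr.
Qed.

Lemma abs_cont_sum c d n (g : 'I_n -> R -> R) : (forall i, abs_cont c d (g i)) ->
  abs_cont c d (fun t => \sum_i g i t).
Proof.
move=> ag.
have : forall r : seq 'I_n, abs_cont c d (fun t => \sum_(i <- r) g i t).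
  elim=> [|i r IHr].
    under eq_fun do rewrite big_nil.
    exact: abs_cont_cst.
  under eq_fun do rewrite big_cons.
  exact: abs_contD (ag i) IHr.
exact.
Qed.

Lemma abs_cont_continuous c d g : abs_cont c d g ->
  {within `[c, d], continuous g}.
Proof.
move=> ag; apply/subspace_continuousP => x; rewrite /= in_itv/= => /andP[cx xd].
apply/cvgrPdist_lt => e e0; have [r r0 gr] := ag _ e0.
apply: (@filterS _ (nbhs x) _ [set y : R | `|x - y| < r]); last exact: nbhsx_ballx.
move=> y /= xy; rewrite in_itv/= => /andP[cy yd].
wlog le_xy : x y cx xd cy yd xy / x <= y.
  move=> W; have [le_xy|/ltW le_yx] := leP x y; first exact: W.
  by rewrite distrC; apply: W => //; rewrite distrC.
(* Absolute continuity for the family consisting of the single interval []x, y[]. *)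
have := gr 1%N (fun=> x) (fun=> y).
rewrite !big_ord1 distrC; apply => //.
  by move=> i j _ _ _; rewrite (ord1 i) (ord1 j).
by rewrite -[ltLHS]ger0_norm ?subr_ge0// distrC.
Qed.

Lemma abs_cont_bounded c d g : c <= d -> abs_cont c d g ->
  exists M, forall t, c <= t -> t <= d -> `|g t| <= M.
Proof.
move=> cd ag; have cg := abs_cont_continuous ag.
have [|s _ gs] := @EVT_max R (fun t => `|g t|) c d cd.
  by move=> t; apply: continuous_comp; [exact: cg|exact: norm_continuous].
by exists `|g s| => t ct td; apply: gs; rewrite in_itv/= ct.
Qed.

Lemma abs_contM c d g h : c <= d -> abs_cont c d g -> abs_cont c d h ->
  abs_cont c d (fun t => g t * h t).
Proof.
move=> cd ag ah.
have [M gM] := abs_cont_bounded cd ag; have [N hN] := abs_cont_bounded cd ah.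
apply: (abs_cont_dominated (M := Num.max M N) ag ah) => s t cs st td.
have -> : g t * h t - g s * h s = (g t - g s) * h t + g s * (h t - h s) by ring.
apply: le_trans (ler_normD _ _) _; rewrite !normrM mulrDr mulrC lerD//.
  by rewrite ler_wpM2r// le_max hN ?orbT// (le_trans cs).
by rewrite ler_wpM2r// le_max gM// (le_trans st).
Qed.

End scalar_absolute_continuity.

(** * Monotonicity by a covering argument *)

Section nonincreasing.
Context {R : realType}.
Implicit Types (g : R -> R).

(* The part of [s, t] covered by [l] carries the exceptional points; on the
   rest of [s, t] the increments of [g] are at most [eps] times the length. *)
Let covered g (U : set R) (eps s t : R) : Prop := exists l : seq (R * R),
  [/\ {in l, forall i, s <= i.1 /\ i.1 <= i.2 /\ i.2 <= t},
      {in l, forall i, `]i.1, i.2[%classic `<=` U},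
      pairwise (fun i j => i.2 <= j.1) l &
      g t - g s <= \sum_(i <- l) `|g i.2 - g i.1| + eps * (t - s)].

Lemma covered_trans g U eps s t r : s <= t -> t <= r ->
  covered g U eps s t -> covered g U eps t r -> covered g U eps s r.
Proof.
move=> st tr [l [l1 l2 l3 l4]] [k [k1 k2 k3 k4]]; exists (l ++ k); split.
- move=> i; rewrite mem_cat => /orP[/l1|/k1] [? []] ? ?; do ?split => //.
    exact: le_trans tr.
  exact: le_trans st _.
- by move=> i; rewrite mem_cat => /orP[/l2|/k2].
- rewrite pairwise_cat l3 k3 !andbT; apply/allrelP => i j /l1[_ [_ it]] /k1[tj _].
  exact: le_trans tj.
- rewrite big_cat /=; move: l4 k4; set a := \sum_(i <- l) _; set b := \sum_(i <- k) _.
  lra.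
Qed.

Lemma covered_open g U eps s t : 0 <= eps -> s <= t -> `]s, t[%classic `<=` U ->
  covered g U eps s t.
Proof.
move=> e0 st stU; exists [:: (s, t)]; split => //.
- by move=> i; rewrite inE => /eqP ->.
- by move=> i; rewrite inE => /eqP ->.
- rewrite big_seq1 /=; have := ler_norm (g t - g s).
  have : 0 <= eps * (t - s) by rewrite mulr_ge0// subr_ge0.
  lra.
Qed.

Lemma covered_increment g U eps s t : g t - g s <= eps * (t - s) ->
  covered g U eps s t.
Proof. by move=> h; exists [::]; split => //; rewrite big_nil add0r. Qed.

(** Local to global, as in Cousin's lemma: let [T] be the supremum of the [t] for which [[a, t]] is
    covered. The condition at [T] covers [[a, T]] from the left and, if [T < b], extends the cover
    beyond [T]. *)
Lemma covered_cousin g U eps a b : a <= b ->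
  (forall x, a <= x <= b -> exists2 r, 0 < r & forall y, a <= y <= b ->
     `|x - y| < r -> (y <= x -> covered g U eps y x) /\ (x <= y -> covered g U eps x y)) ->
  covered g U eps a b.
Proof.
move=> ab loc.
pose S := [set t | a <= t <= b /\ covered g U eps a t].
have Sa : S a.
  by split; [rewrite lexx|apply: covered_increment; rewrite !subrr mulr0].
have Sb : ubound S b by move=> t [/andP[]].
have supS : has_sup S by split; [exists a|exists b].
set T := sup S.
have aT : a <= T by apply: ub_le_sup => //; exists b.
have Tb : T <= b by apply: ge_sup => //; exists a.
have [r r0 locT] := loc T ltac:(by rewrite aT).
have [s [/andP[as_ sb] cas] Tr] := sup_adherent r0 supS.
have sT : s <= T by apply: ub_le_sup => //; [exists b|split => //; rewrite as_].
have caT : covered g U eps a T.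
  apply: covered_trans cas _ => //; apply: (proj1 (locT s _ _)) => //.
    by rewrite as_.
  by rewrite ger0_norm ?subr_ge0// ltrBlDl -ltrBlDr.
have [/eqP bT|bT] := eqVneq T b; first by rewrite -(eqP bT).
have {}bT : T < b by rewrite lt_neqAle bT.
pose t := Num.min b (T + r / 2).
have Tt : T < t by rewrite lt_min bT ltrDl divr_gt0.
have tb : t <= b by rewrite ge_min lexx.
suff /(ub_le_sup (ex_intro _ b Sb)) : S t by rewrite leNgt Tt.
split; first by rewrite tb (le_trans aT)// ltW.
apply: covered_trans caT _ => //; first exact: ltW.
apply: (proj2 (locT t _ _)); last exact: ltW.
  by rewrite tb (le_trans aT)// ltW.
rewrite distrC ger0_norm ?subr_ge0 ?(ltW Tt)//.
apply: (@le_lt_trans _ _ (r / 2)); last by rewrite ltr_pdivrMr// ltr_pMr// ltr1n.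
by rewrite lerBlDl ge_min lexx orbT.
Qed.

(** The intervals of the list are disjoint and lie in [U], so their total length is below [delta]
    and absolute continuity bounds their increments by [eps]. *)
Lemma covered_abs_cont_lt g U eps delta s t :
  (forall (N : nat) (p q : 'I_N -> R),
      (forall i, s <= p i /\ p i <= q i /\ q i <= t) ->
      trivIset [set: 'I_N] (fun i => `]p i, q i[%classic) ->
      \sum_(i < N) (q i - p i) < delta ->
      \sum_(i < N) `|g (q i) - g (p i)| < eps) ->
  measurable U -> (lebesgue_measure U < delta%:E)%E ->
  covered g U eps s t -> g t - g s <= eps + eps * (t - s).
Proof.
move=> ac mU Ud [l [l1 l2 l3 l4]].
pose p (i : 'I_(size l)) := (nth (0, 0) l i).1.
pose q (i : 'I_(size l)) := (nth (0, 0) l i).2.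
have pq i : s <= p i /\ p i <= q i /\ q i <= t by apply: l1; exact: mem_nth.
have tI : trivIset [set: 'I_(size l)] (fun i => `]p i, q i[%classic).
  move=> i j _ _ [x []]; rewrite /= !in_itv/= => /andP[px xq] /andP[px' xq'].
  have lt (k k' : 'I_(size l)) : (k < k')%N -> q k <= p k'.
    by move=> kk'; move/(pairwiseP (0, 0)) : l3; apply; rewrite ?inE.
  apply/val_inj; case: (ltngtP i j) => // /lt qp.
    by have := lt_le_trans (lt_trans px' xq) qp; rewrite ltxx.
  by have := lt_le_trans (lt_trans px xq') qp; rewrite ltxx.
apply: le_trans l4 _; rewrite lerD2r ltW// (big_nth (0, 0)) big_mkord.
apply: (ac _ p q) => //.
rewrite -lte_fin; apply: le_lt_trans Ud.
have mI i : measurable (`]p i, q i[%classic : set R) by exact: measurable_itv.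
apply: (@le_trans _ _ (lebesgue_measure (\big[setU/set0]_i `]p i, q i[%classic))).
  rewrite (measure_bigsetU_ord lebesgue_measure xpredT mI tI) -sumEFin.
  apply: lee_sum => i _; rewrite /= lebesgue_measure_itv/= lte_fin.
  by case: ltP => // qp; rewrite lee_fin subr_le0.
apply: le_measure; rewrite ?inE//.
  by apply: bigsetU_measurable => i _; exact: mI.
apply: (big_ind (fun V => V `<=` U)) => // [V W VU WU x [/VU|/WU]//|i _ x].
by apply: l2; exact: mem_nth.
Qed.

(* Cover the exceptional null set by an open set so small that, by absolute
   continuity, [g] varies by at most [eps] on it. *)
Lemma abs_cont_nonincreasing g (a b : R) (B : set R) : a <= b -> abs_cont a b g ->
  (@lebesgue_measure R).-negligible B ->
  (forall t, a <= t <= b -> ~ B t -> exists2 D, D <= 0 & is_derive t (1 : R) g D) ->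
  g b <= g a.
Proof.
move=> ab ag [Z [mZ Z0 BZ]] dg.
have key eps : 0 < eps -> g b - g a <= eps + eps * (b - a).
  move=> e0; have [delta d0 Hd] := ag _ e0.
  have [|U [oU ZU Ud]] := @lebesgue_regularity_outer R Z delta mZ _ d0.
    by move: Z0 => /= Z0; rewrite [X in (X < _)%E]Z0 ltry.
  have mU : measurable (U : set R) by exact: measurable_realfun.open_measurable.
  have {}Ud : (lebesgue_measure U < delta%:E)%E.
    have mUZ : measurable (U `\` Z) by exact: measurableD.
    apply: le_lt_trans Ud.
    rewrite -{1}(setDUK ZU); apply: le_trans (measureU2 _ _ _) _ => //.
    by move: Z0 => /= ->; rewrite add0e.
  apply: (covered_abs_cont_lt Hd mU Ud).
  apply: covered_cousin => // x xab.
  (* Near a point of [Z], short intervals lie in the open set [U]; near any other point, a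
     derivative at most [0] keeps the difference quotients below [eps]. *)
  have [Zx|Zx] := pselect (Z x).
    have /nbhs_ballP[r r0 rU] : nbhs x U by move: oU; rewrite openE; apply; exact: ZU.
    exists r => // y yab xy; split => le_xy; apply: covered_open => //; try exact: ltW.
      move=> z /=; rewrite in_itv/= => /andP[yz zx]; apply: rU.
      apply: le_lt_trans xy; rewrite !ger0_norm ?subr_ge0// ?(ltW zx)//.
      by rewrite lerB// ltW.
    move=> z /=; rewrite in_itv/= => /andP[xz zy]; apply: rU.
    apply: le_lt_trans xy; rewrite !ler0_norm ?subr_le0// ?(ltW xz)//.
    by rewrite lerN2 lerB// ltW.
  have [D D0 [dgx gD]] := dg x xab (fun Bx => Zx (BZ _ Bx)).
  have : h^-1 *: (g (h *: 1 + x) - g x) @[h --> 0^'] --> D by rewrite -gD.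
  move/cvgr_lt => /(_ eps (le_lt_trans D0 e0)) /nbhs_ballP[r /= r0 Hr].
  exists r => // y yab xy.
  have inc : x != y -> (y - x)^-1 * (g y - g x) < eps.
    move=> xney; have /= := Hr (y - x).
    rewrite /ball/= sub0r normrN distrC [_ *: 1]mulr1 subrK; apply => //.
    by rewrite subr_eq0 eq_sym.
  have [<-|xney] := eqVneq x y.
    by split=> _; apply: covered_increment; rewrite !subrr mulr0.
  move: inc => /(_ xney) inc; split => le_xy; apply: covered_increment.
    have yx : 0 < x - y by rewrite subr_gt0 lt_neqAle eq_sym xney.
    move: inc; rewrite -opprB invrN mulNr -mulrN opprB mulrC ltr_pdivrMr//.
    exact: ltW.
  have yx : 0 < y - x by rewrite subr_gt0 lt_neqAle xney.
  by move: inc; rewrite mulrC ltr_pdivrMr// => /ltW.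
rewrite -subr_le0; apply/ler_addgt0Pl => e e0; rewrite addr0.
have l0 : 0 < 1 + (b - a) by rewrite ltr_wpDr// subr_ge0.
(* Chosen so that [eps + eps * (b - a)] equals [e]. *)
have := key (e / (1 + (b - a))) (divr_gt0 e0 l0).
by rewrite -{1}[e / _]mulr1 -mulrDr divfK// gt_eqF.
Qed.

End nonincreasing.

(** * Exponential decay of the Lyapunov function *)

Section curves.
Context {R : realType}.

Lemma is_derive_entry n (u : R -> 'cV[R]_n) (du : 'cV[R]_n) (t : R) i :
  is_derive t (1 : R) u du -> is_derive t (1 : R) (fun s => u s i 0) (du i 0).
Proof.
move=> [dud <-]; have := (derivable_mxP u t 1).1 dud i 0 => dui.
by split => //; rewrite derive_mx// mxE.
Qed.

Lemma is_derive_sum_fun n (h : 'I_n -> R -> R) (dh : 'I_n -> R) (t : R) :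
  (forall i, is_derive t (1 : R) (h i) (dh i)) ->
  is_derive t (1 : R) (fun s => \sum_i h i s) (\sum_i dh i).
Proof.
move=> hd; have -> : (fun s => \sum_i h i s) = \sum_i h i.
  by apply/funext => s; rewrite fct_sumE.
exact: is_derive_sum.
Qed.

Lemma is_derive_inner n (u v : R -> 'cV[R]_n) (du dv : 'cV[R]_n) (t : R) :
  is_derive t (1 : R) u du -> is_derive t (1 : R) v dv ->
  is_derive t (1 : R) (fun s => inner (u s) (v s)) (inner du (v t) + inner (u t) dv).
Proof.
move=> ud vd; under eq_fun do rewrite innerE.
rewrite !innerE -big_split /=; apply: is_derive_sum_fun => i.
have dui := is_derive_entry i ud; have dvi := is_derive_entry i vd.
have -> : du i 0 * v t i 0 + u t i 0 * dv i 0 = u t i 0 *: dv i 0 + v t i 0 *: du i 0.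
  by rewrite addrC [X in _ + X]mulrC.
exact: is_deriveM.
Qed.

Lemma is_derive_mulmx n m (A : 'M[R]_(m, n)) (u : R -> 'cV[R]_n) (du : 'cV[R]_n) (t : R) :
  is_derive t (1 : R) u du -> is_derive t (1 : R) (fun s => A *m u s) (A *m du).
Proof.
move=> ud.
have dA i : is_derive t (1 : R) (fun s => (A *m u s) i 0) ((A *m du) i 0).
  under eq_fun do rewrite mxE.
  rewrite mxE; apply: is_derive_sum_fun => j.
  have duj := is_derive_entry j ud.
  exact: (is_deriveZ (A i j) duj).
have Ad : derivable (fun s => A *m u s) t 1.
  by apply/derivable_mxP => i j; rewrite (ord1 j); case: (dA i).
split => //; rewrite derive_mx//; apply/colP => i; rewrite mxE.
by case: (dA i).
Qed.

Lemma abs_cont_entry n (u : R -> 'cV[R]_n) (k : 'cV[R]_n) c d i :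
  absolutely_continuous_on c d u -> abs_cont c d (fun t => (u t - k) i 0).
Proof.
move=> au e e0; have [r r0 ur] := au e e0; exists r => // N p q pq triv pqr.
apply: le_lt_trans (ur N p q pq triv pqr); apply: ler_sum => j _.
by have := entry_le_enorm (u (q j) - u (p j)) i; rewrite !mxE opprB addrA subrK.
Qed.

Lemma abs_cont_inner n (u v : R -> 'cV[R]_n) c d : c <= d ->
  (forall i, abs_cont c d (fun t => u t i 0)) ->
  (forall i, abs_cont c d (fun t => v t i 0)) ->
  abs_cont c d (fun t => inner (u t) (v t)).
Proof.
move=> cd au av; under eq_fun do rewrite innerE.
apply: (abs_cont_sum (g := fun i t => u t i 0 * v t i 0)) => i.
exact: abs_contM cd (au i) (av i).
Qed.

Lemma is_derive_expR_mul (k r : R) :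
  is_derive r (1 : R) (fun t => expR (k * t)) (k * expR (k * r)).
Proof.
have dk : is_derive r (1 : R) (fun t : R => k * t) k.
  by apply: is_derive_eq; rewrite [LHS]mulr1.
rewrite mulrC; exact: (@is_derive1_comp _ expR (fun t : R => k * t)).
Qed.

(** By the mean value theorem the function is Lipschitz on [[c, d]]; [M] bounds its derivative
    because [|r| <= |c| + |d|] there. *)
Lemma abs_cont_expR c d (k : R) : abs_cont c d (fun t => expR (k * t)).
Proof.
pose M := `|k| * expR (`|k| * (`|c| + `|d|)).
apply: (abs_cont_lipschitz (M := M)) => s t cs st td.
have dE := is_derive_expR_mul k.
have [r /itvP rst ->] : exists2 r, r \in `[s, t] &
    expR (k * t) - expR (k * s) = k * expR (k * r) * (t - s).
  apply: (MVT_segment st) => //.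
  apply: continuous_subspaceT => r; apply: differentiable_continuous.
  by apply/derivable1_diffP; case: (dE r).
rewrite !normrM (@ger0_norm _ (t - s)) ?subr_ge0// ler_wpM2r ?subr_ge0//.
rewrite /M ler_wpM2l// ger0_norm ?expR_ge0// ler_expR.
apply: le_trans (ler_norm _) _; rewrite normrM ler_wpM2l//.
have cr : c <= r by apply: le_trans cs _; rewrite rst.
have rd : r <= d by apply: le_trans td; rewrite rst.
have := ler_norm d; have := ler_norm (- c); rewrite normrN.
have := normr_ge0 c; have := normr_ge0 d.
by move=> d0 c0 cc dd; rewrite ler_norml; apply/andP; split; lra.
Qed.

End curves.

(** * Dissipation and decay *)

Section lyapunov.
Context {R : realType} {n m : nat}.
Variables (f : 'cV[R]_n -> R) (A : 'M[R]_(m, n)) (b : 'cV[R]_m).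
Variables (mu l sigma kappa eta alpha : R).
Hypothesis df : forall x, differentiable f x.
Hypotheses (mu_gt0 : 0 < mu) (kappa_gt0 : 0 < kappa).
Hypothesis f_strong : strongly_convex mu f.
Hypothesis f_lip : lipschitz_gradient l f.
Hypothesis A_upper : loewner_le (A *m A^T) sigma%:M.
Hypothesis A_lower : loewner_le kappa%:M (A *m A^T).
Hypotheses (eta_gt0 : 0 < eta) (alpha_gt0 : 0 < alpha).
Hypothesis param : 2 * eta > l * alpha + mu / (kappa * alpha).

(** This is [w] of the overview, kept as a linear map so that it applies to deviations and
    velocities alike. *)
Let aw (x : 'cV[R]_n) (y : 'cV[R]_m) := x + alpha *: (A^T *m y).

Lemma mulmx_tr_lower (y : 'cV[R]_m) :
  kappa * inner y y <= inner (A^T *m y) (A^T *m y).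
Proof.
have [_ /(_ y)] := A_lower.
by rewrite mulmxBl mul_scalar_mx innerDr innerNr innerZr -mulmxA (inner_mulmxr A) subr_ge0.
Qed.

Lemma mulmx_tr_upper (y : 'cV[R]_m) :
  inner (A^T *m y) (A^T *m y) <= sigma * inner y y.
Proof.
have [_ /(_ y)] := A_upper.
by rewrite mulmxBl mul_scalar_mx innerDr innerNr innerZr -mulmxA (inner_mulmxr A) subr_ge0.
Qed.

(** The components differ only where [y_j = 0]; there the projection can only raise [s_j], while the
    factor [y_j - ys_j] is nonpositive. *)
Lemma proj_plus_le (s y ys : 'cV[R]_m) : nneg_vec y -> nneg_vec ys ->
  inner (proj_plus s y) (y - ys) <= inner s (y - ys).
Proof.
move=> y0 ys0; rewrite !innerE; apply: ler_sum => j _; rewrite !mxE.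
case: ifPn => // yj; have -> : y j 0 = 0 by apply/le_anti; rewrite y0 leNgt yj.
by rewrite sub0r !mulrN lerN2 ler_wpM2r// le_max lexx.
Qed.

Lemma field_dissipative xs ys x y :
  saddle_point (lagrangian f A b eta) xs ys -> nneg_vec y ->
  inner (aw (primal_field f A b eta alpha x y) (dual_field f A b eta alpha x y))
        (aw (x - xs) (y - ys)) +
  inner (dual_field f A b eta alpha x y) (y - ys) <=
  - mu * (inner (aw (x - xs) (y - ys)) (aw (x - xs) (y - ys)) +
          inner (y - ys) (y - ys)).
Proof.
move=> sad y0.
set w := aw (x - xs) _; set F := primal_field _ _ _ _ _ _ _; set G := dual_field _ _ _ _ _ _ _.
have ys0 := proj1 sad.
have gE : grad f xs = - (eta *: (A^T *m ys)).
  by apply/eqP; rewrite -addr_eq0 (saddle_stationary df sad).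
have co := saddle_complementarity eta_gt0 sad y0.
set X := x - xs in w *; set Y := y - ys in w co *.
pose g := grad f x - grad f xs; pose a := A^T *m Y.
have gradE : grad f x + eta *: (A^T *m y) = g + eta *: a.
  rewrite /g /a gE opprK mulmxBr scalerBr -addrA; congr (_ + _).
  by rewrite addrC subrK.
(* The dual velocity in the primal field cancels: this is why [w] is used. *)
have FE : aw F G = - (g + eta *: a).
  rewrite -gradE /aw /F /primal_field -/G -addrA addNr addr0.
  by rewrite opprD.
(* The cross term [eta <a, X>] cancels against the one from [<aw F G, w>]. *)
have GY : inner G Y <= - alpha * inner (g + eta *: a) a +
    eta * inner a X + eta * inner Y (A *m xs - b).
  apply: le_trans (proj_plus_le _ y0 ys0) _; rewrite gradE -/Y.
  have -> : A *m x - b = A *m X + (A *m xs - b) by rewrite mulmxBr addrA subrK.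
  rewrite innerC innerDr !innerZr (innerDr _ (A *m X)) !(inner_mulmxr A Y) -/a.
  by rewrite (innerC a (g + _)) mulrDr addrA.
(* With [v = alpha a] the left side is [mu |w|^2], and the inner product on the right is the
   [<g, X + 2 alpha a>] left over from the two velocities. *)
have coco := gradient_cocoercive df x xs (alpha *: a) f_strong f_lip.
rewrite -/X -/g in coco.
have aY : mu * inner Y Y <= mu / kappa * inner a a.
  rewrite mulrAC ler_pdivlMr// -mulrA ler_wpM2l ?(ltW mu_gt0)// mulrC.
  exact: mulmx_tr_lower.
have etaco : eta * inner Y (A *m xs - b) <= 0.
  by rewrite mulr_ge0_le0// ltW.
(* The parameter condition multiplied by [alpha]: the term [- 2 alpha eta |a|^2] absorbs
   [l alpha^2 |a|^2] from [coco] and [mu / kappa |a|^2] from [aY]. *)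
have par : (l * alpha ^+ 2 + mu / kappa - 2 * alpha * eta) * inner a a <= 0.
  rewrite mulr_le0_ge0 ?inner_ge0// subr_le0.
  have -> : l * alpha ^+ 2 + mu / kappa = alpha * (l * alpha + mu / (kappa * alpha)).
    by field; rewrite !gt_eqF.
  have -> : 2 * alpha * eta = alpha * (2 * eta) by ring.
  by rewrite ler_pM2l// ltW.
rewrite FE /w /aw -/a.
move: GY coco aY etaco par; set r := A *m xs - b.
clearbody r a g X Y; rewrite !inner_lin.
rewrite ?(innerC X a) ?(innerC X g) ?(innerC a g).
lra.
Qed.

Let V (X : 'cV[R]_n) (Y : 'cV[R]_m) := inner (aw X Y) (aw X Y) + inner Y Y.

Let K := Num.max 2 (2 * sigma * alpha ^+ 2 + 1).

Lemma parallelogram_le (u v : 'cV[R]_n) :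
  inner (u + v) (u + v) <= 2 * inner u u + 2 * inner v v.
Proof. by have := inner_ge0 (u - v); rewrite !inner_lin (innerC v u); lra. Qed.

(** The parallelogram bound produces the coefficients [2] for [|X|^2] and [2 sigma alpha^2 + 1] for
    [|Y|^2], the two arguments of the maximum. *)
Lemma lyapunov_le X Y : V X Y <= K * (inner X X + inner Y Y).
Proof.
have h := parallelogram_le X (alpha *: (A^T *m Y)).
have hs := ler_wpM2l (sqr_ge0 alpha) (mulmx_tr_upper Y).
have X0 := inner_ge0 X; have Y0 := inner_ge0 Y.
have K1 : 2 <= K by rewrite le_max lexx.
have K2 : 2 * sigma * alpha ^+ 2 + 1 <= K by rewrite le_max lexx orbT.
have KX := ler_wpM2r X0 K1; have KY := ler_wpM2r Y0 K2.
move: h; rewrite innerZl innerZr /V /aw; move: hs KX KY.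
set a := inner (A^T *m Y) _; nra.
Qed.

Lemma lyapunov_ge X Y : inner X X + inner Y Y <= K * V X Y.
Proof.
(* The same estimate with the roles exchanged, since [X = aw X Y - alpha A^T Y]. *)
have h := parallelogram_le (aw X Y) (- (alpha *: (A^T *m Y))).
rewrite /aw addrK -/(aw X Y) in h.
have hs := ler_wpM2l (sqr_ge0 alpha) (mulmx_tr_upper Y).
have X0 := inner_ge0 (aw X Y); have Y0 := inner_ge0 Y.
have K1 : 2 <= K by rewrite le_max lexx.
have K2 : 2 * sigma * alpha ^+ 2 + 1 <= K by rewrite le_max lexx orbT.
have KX := ler_wpM2r X0 K1; have KY := ler_wpM2r Y0 K2.
move: h; rewrite innerNl innerNr opprK innerZl innerZr /V; move: hs KX KY.
set a := inner (A^T *m Y) _; nra.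
Qed.

Lemma lyapunov_decay xs ys (x : R -> 'cV[R]_n) (y : R -> 'cV[R]_m) (T : R) :
  saddle_point (lagrangian f A b eta) xs ys ->
  caratheodory_solution (primal_field f A b eta alpha)
    (dual_field f A b eta alpha) x y ->
  0 <= T ->
  expR (2 * mu * T) * V (x T - xs) (y T - ys) <= V (x 0 - xs) (y 0 - ys).
Proof.
move=> sad [acx acy y0 dxy] T0.
pose Y t := y t - ys; pose w t := aw (x t - xs) (Y t).
pose E t := expR (2 * mu * t) * (inner (w t) (w t) + inner (Y t) (Y t)).
suff : E T <= E 0 by rewrite /E mulr0 expR0 mul1r.
have aY i : abs_cont 0 T (fun t => Y t i 0) := abs_cont_entry ys i (acy _ T0).
have aW i : abs_cont 0 T (fun t => w t i 0).
  have -> : (fun t => w t i 0) =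
      (fun t => (x t - xs) i 0 + alpha * \sum_j A j i * Y t j 0).
    by apply/funext => t; rewrite !mxE; under eq_bigr do rewrite mxE.
  apply: abs_contD (abs_cont_entry xs i (acx _ T0)) _.
  apply: abs_contZ; apply: (@abs_cont_sum _ _ _ _ (fun j t => A j i * Y t j 0)) => j.
  exact: abs_contZ.
have acE : abs_cont 0 T E.
  apply: (@abs_contM _ _ _ (fun t => expR (2 * mu * t))) => //.
    exact: abs_cont_expR.
  exact: abs_contD (abs_cont_inner T0 aW aW) (abs_cont_inner T0 aY aY).
(* The equations hold only at positive times, so [0] joins the exceptional set. *)
have neg0 : (@lebesgue_measure R).-negligible [set (0 : R)].
  by apply/negligibleP; [exact: measurable_set1|exact: lebesgue_measure_set1].
apply: (abs_cont_nonincreasing T0 acE (negligibleU dxy neg0)).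
move=> t /andP[t0 tT] /not_orP[/contrapT Pt /eqP tn0].
have {}t0 : 0 < t by rewrite lt_neqAle eq_sym tn0.
have [dx dy] := Pt t0.
set F := primal_field _ _ _ _ _ _ _ in dx; set G := dual_field _ _ _ _ _ _ _ in dy.
have dY : is_derive t (1 : R) Y G.
  by rewrite -[G]subr0; exact: is_deriveB.
have dW : is_derive t (1 : R) w (aw F G).
  have dX : is_derive t (1 : R) (fun s => x s - xs) F.
    by rewrite -[F]subr0; exact: is_deriveB.
  have dAY := is_derive_mulmx A^T dY.
  exact: is_deriveD dX (is_deriveZ alpha dAY).
have dWW := is_derive_inner dW dW; have dYY := is_derive_inner dY dY.
have dexp := is_derive_expR_mul (2 * mu) t.
have dV := is_deriveD dWW dYY.
have dE := is_deriveM dexp dV.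
eexists; last exact: dE.
have := field_dissipative (x t) sad (y0 _ (ltW t0)); rewrite -/F -/G -/(Y t) -/(w t) => dis.
rewrite !scaleRE (innerC (w t)) (innerC (Y t) G) /=.
have -> : (( fun s => inner (w s) (w s)) + (fun s => inner (Y s) (Y s))) t =
  inner (w t) (w t) + inner (Y t) (Y t) by [].
have := expR_gt0 (2 * mu * t); set e := expR _ => e0.
set p := inner (aw F G) _ in dis *; set q := inner G _ in dis *.
set v := inner _ _ + inner _ _ in dis *.
have -> : e * (p + p + (q + q)) + v * (2 * mu * e) = 2 * e * (p + q + mu * v) by ring.
rewrite pmulr_rle0 ?mulr_gt0//; lra.
Qed.

Lemma exponential_bound xs ys (x : R -> 'cV[R]_n) (y : R -> 'cV[R]_m) (t : R) :
  saddle_point (lagrangian f A b eta) xs ys ->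
  caratheodory_solution (primal_field f A b eta alpha)
    (dual_field f A b eta alpha) x y ->
  0 <= t ->
  enorm (col_mx (x t - xs) (y t - ys)) <=
    K * enorm (col_mx (x 0 - xs) (y 0 - ys)) * expR (- (mu * t)).
Proof.
move=> sad sol t0; have := lyapunov_decay sad sol t0.
have K0 : 0 <= K by rewrite le_max ler0n.
have := lyapunov_ge (x t - xs) (y t - ys).
have := lyapunov_le (x 0 - xs) (y 0 - ys).
rewrite -!inner_col_mx -!enorm_sqr.
set z0 := enorm (col_mx (x 0 - xs) _); set z := enorm _.
set v := V _ _; set v0 := V _ _ => v0z zv dec.
(* For the squares the chain is [z^2 <= K v <= K e^(- 2 mu t) v0 <= K^2 e^(- 2 mu t) z0^2]; each
   comparison of norms costs one [K], so the root leaves a single [K]. *)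
rewrite -ler_sqr ?nnegrE ?enorm_ge0 ?mulr_ge0 ?expR_ge0 ?enorm_ge0//.
have -> : (K * z0 * expR (- (mu * t))) ^+ 2 = K * (K * z0 ^+ 2) * expR (- (2 * mu * t)).
  rewrite !exprMn -expRM_natl; have -> : 2%:R * - (mu * t) = - (2 * mu * t) by ring.
  by ring.
apply: le_trans zv _; rewrite -mulrA ler_wpM2l//.
by rewrite expRN ler_pdivlMr ?expR_gt0// mulrC (le_trans dec).
Qed.

End lyapunov.

Theorem proposition17 (R : realType) (n m : nat) (f : 'cV[R]_n -> R)
    (A : 'M[R]_(m, n)) (b : 'cV[R]_m) (mu l sigma kappa eta alpha : R)
    (f_C1 : continuously_differentiable f)
    (f_convex : convex_function [set: 'cV[R]_n] f)
    (mu_gt0 : 0 < mu) (l_gt0 : 0 < l)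
    (sigma_gt0 : 0 < sigma) (kappa_gt0 : 0 < kappa)
    (f_strong : strongly_convex mu f)
    (f_lip : lipschitz_gradient l f)
    (A_full : row_free A)
    (A_upper : loewner_le (A *m A^T) sigma%:M)
    (A_lower : loewner_le kappa%:M (A *m A^T))
    (eta_gt0 : 0 < eta) (alpha_gt0 : 0 < alpha)
    (param : 2 * eta > l * alpha + mu / (kappa * alpha)) :
  (exists! zs : 'cV[R]_n * 'cV[R]_m,
     saddle_point (lagrangian f A b eta) zs.1 zs.2) /\
  (forall (xs : 'cV[R]_n) (ys : 'cV[R]_m),
     saddle_point (lagrangian f A b eta) xs ys ->
   forall (x : R -> 'cV[R]_n) (y : R -> 'cV[R]_m),
     caratheodory_solution (primal_field f A b eta alpha)
       (dual_field f A b eta alpha) x y ->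
   forall t : R, 0 <= t ->
     enorm (col_mx (x t - xs) (y t - ys)) <=
       Num.max 2 (2 * sigma * alpha ^+ 2 + 1) *
       enorm (col_mx (x 0 - xs) (y 0 - ys)) * expR (- (mu * t))).
Proof.
have df : forall x, differentiable f x by case: f_C1.
split.
  have [xs [ys sad]] := saddle_exists b df mu_gt0 f_strong A_full eta_gt0.
  exists (xs, ys); split => // -[xs' ys'] sad'.
  by have [-> ->] := saddle_unique df mu_gt0 f_strong A_full eta_gt0 sad sad'.
move=> xs ys sad x y sol t t0.
exact: (exponential_bound df mu_gt0 kappa_gt0 f_strong f_lip A_upper A_lower
          eta_gt0 alpha_gt0 param sad sol t0).
Qed.
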